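(* For $n\in\omega$ let $G_n$ be the graph with vertex set $\{0,1,2,3\}^n$ and edge relation $E_n$ defined as follows: $x\,E_n\,x$ for every $x\in G_n$, and for $x\neq y$ we put $x\,E_n\,y$ if and only if one of the following holds: (a) there is $l<n$ such that $x(k)=y(k)$ for all $k<l$, $\{x(l),y(l)\}=\{2,3\}$, and $x(k)=y(k)\in\{0,1\}$ for all $k$ with $l<k<n$; (b) $n\geq 1$, $\{x(0),y(0)\}=\{0,1\}$ and $x(k)=y(k)\in\{0,1\}$ for all $k$ with $1\leq k<n$. For $k\leq n$ let $p^n_k\colon G_n\to G_k$ be the restriction to the first $k$ coordinates, $p^n_k(x)=(x(0),\dots,x(k-1))$. Then the inverse sequence $$G_0\xleftarrow{\;p^1_0\;}G_1\xleftarrow{\;p^2_1\;}G_2\leftarrow\cdots$$ is a Fraïssé sequence in the category of finite graphs with quotient maps.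
   Context: A graph is a pair $(V,E)$ where $E$ is a symmetric and reflexive binary relation on $V$ (every vertex has a loop). A homomorphism is an edge-preserving map. A homomorphism $f\colon X\to Y$ is strict if for all adjacent $p,q$ in the range of $f$ there are adjacent $a,b\in X$ with $f(a)=p$, $f(b)=q$; a surjective strict homomorphism is called a quotient map. An inverse sequence of finite graphs $G_0\leftarrow G_1\leftarrow G_2\leftarrow\cdots$ whose bonding maps $q^n_k\colon G_n\to G_k$ ($k\le n$) are quotient maps is called a Fraïssé sequence (in the category of finite graphs with quotient maps) if for every $k$, every finite graph $H$ and every quotient map $g\colon H\to G_k$ there exist $n>k$ and a quotient map $f\colon G_n\to H$ such that $g\circ f=q^n_k$. *)

(* Defs.v *)
From mathcomp Require Import all_boot.

Set Implicit Arguments.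
Unset Strict Implicit.
Unset Printing Implicit Defensive.

Record fgraph := FGraph {
  vertex :> finType;
  adj : rel vertex;
  adj_refl : reflexive adj;
  adj_sym : symmetric adj
}.

Definition graph_hom (X Y : fgraph) (f : X -> Y) : Prop :=
  forall a b : X, adj a b -> adj (f a) (f b).

Definition strict (X Y : fgraph) (f : X -> Y) : Prop :=
  graph_hom f /\
  forall p q : Y, p \in codom f -> q \in codom f -> adj p q ->
    exists a b : X, [/\ adj a b, f a = p & f b = q].

Definition quotient_map (X Y : fgraph) (f : X -> Y) : Prop :=
  strict f /\ forall y : Y, exists x : X, f x = y.

Definition inverse_sequence (G : nat -> fgraph)
    (q : forall k n : nat, k <= n -> G n -> G k) : Prop :=
  [/\ forall k n (kn : k <= n), quotient_map (q k n kn),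
      forall n (nn : n <= n), q n n nn =1 id
    & forall k m n (km : k <= m) (mn : m <= n) (kn : k <= n),
        q k m km \o q m n mn =1 q k n kn].

Definition fraisse_sequence (G : nat -> fgraph)
    (q : forall k n : nat, k <= n -> G n -> G k) : Prop :=
  inverse_sequence q /\
  forall (k : nat) (H : fgraph) (g : H -> G k), quotient_map g ->
    exists (n : nat) (kn : k < n) (f : G n -> H),
      quotient_map f /\ g \o f =1 q k n (ltnW kn).

Definition a0 : 'I_4 := @Ordinal 4 0 isT.
Definition a1 : 'I_4 := @Ordinal 4 1 isT.
Definition a2 : 'I_4 := @Ordinal 4 2 isT.
Definition a3 : 'I_4 := @Ordinal 4 3 isT.

Definition word (n : nat) := {ffun 'I_n -> 'I_4}.

Definition edge_a (n : nat) (x y : word n) : bool :=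
  [exists l : 'I_n,
    [&& [forall k : 'I_n, (k < l) ==> (x k == y k)],
        [set x l; y l] == [set a2; a3]
      & [forall k : 'I_n,
          (l < k) ==> (x k == y k) && (x k \in [set a0; a1])]]].

(* The existential over an index [i] equal to 0 encodes the condition 1 <= n. *)
Definition edge_b (n : nat) (x y : word n) : bool :=
  [exists i : 'I_n,
    [&& i == 0 :> nat,
        [set x i; y i] == [set a0; a1]
      & [forall k : 'I_n,
          (1 <= k) ==> (x k == y k) && (x k \in [set a0; a1])]]].

Definition edge (n : nat) : rel (word n) :=
  fun x y => (x == y) || (edge_a x y || edge_b x y).

Lemma edge_refl n : reflexive (@edge n).
Proof. by move=> x; rewrite /edge eqxx. Qed.

Lemma edge_sym n : symmetric (@edge n).
Proof.
suff sub x y : @edge n x y -> edge y x by move=> x y; apply/idP/idP; apply: sub.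
have tail (P : pred 'I_n) : [forall k, P k ==> (x k == y k) && (x k \in [set a0; a1])] ->
    [forall k, P k ==> (y k == x k) && (y k \in [set a0; a1])].
  move=> /forallP h; apply/forallP=> k; apply/implyP=> Pk.
  by have /andP[/eqP <- ->] := implyP (h k) Pk; rewrite eqxx.
case/or3P=> [/eqP->||]; first exact: edge_refl.
- case/existsP=> l /and3P[/forallP h1 h2 h3]; apply/or3P/Or32; apply/existsP.
  exists l; apply/and3P; split; [|by rewrite setUC|exact: tail h3].
  by apply/forallP=> k; rewrite eq_sym.
- case/existsP=> i /and3P[h1 h2 h3]; apply/or3P/Or33; apply/existsP.
  by exists i; apply/and3P; split; [|rewrite setUC|apply: tail h3].
Qed.

Definition Gn (n : nat) : fgraph := FGraph (@edge_refl n) (@edge_sym n).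

Definition restriction (k n : nat) (kn : k <= n) (x : Gn n) : Gn k :=
  [ffun i : 'I_k => x (widen_ord kn i)].

(* Main.v *)
Require Import Defs.
From mathcomp Require Import all_boot.
From mathcomp Require Import zify.

Set Implicit Arguments.
Unset Strict Implicit.
Unset Printing Implicit Defensive.

(** For n > 0 the graph G_n is a perfect matching: the mate of x is obtained by
    exchanging 0 with 1, or 2 with 3, at the last coordinate of x lying in
    {2,3}, or at coordinate 0 if there is none.  Given a quotient map
    g : H -> G_k, the map G_n -> H is therefore given by assigning to each
    matching edge an edge of H with the same image in G_k.  Over an edge vw of
    G_k lie the pairs (v u, w u) with u binary; over a loop at v lie the pairs
    (v 2 u, v 3 u) with u binary.  For n large the binary tails u can name every
    edge of H, so that all of them are hit; the unused matching edges are sent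
    anywhere, which is possible since g is strict and surjective. *)

(** * The alphabet and its involution *)

Lemma letterP (c : 'I_4) : [\/ c = a0, c = a1, c = a2 | c = a3].
Proof.
case: c => [[|[|[|[|//]]]] c4].
- by constructor 1; apply: val_inj.
- by constructor 2; apply: val_inj.
- by constructor 3; apply: val_inj.
- by constructor 4; apply: val_inj.
Qed.

Definition flip (c : 'I_4) : 'I_4 := nth a0 [:: a1; a0; a3; a2] c.

Lemma flipK : involutive flip.
Proof. by move=> c; case: (letterP c) => ->. Qed.

Lemma flip_gt1 c : (1 < flip c) = (1 < c).
Proof. by case: (letterP c) => ->. Qed.

Lemma odd_flip c : odd (flip c) = ~~ odd c.
Proof. by case: (letterP c) => ->. Qed.

Lemma in_set01 (c : 'I_4) : (c \in [set a0; a1]) = (c < 2).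
Proof. by rewrite !inE; case: (letterP c) => ->. Qed.

Lemma set2_letters (a b c d : 'I_4) :
  ([set a; b] == [set c; d])
  = (a == c) && (b == d) || (a == d) && (b == c).
Proof.
apply/eqP/idP => [eqs|]; last first.
  by case/orP=> /andP[/eqP-> /eqP->] //; rewrite setUC.
have := set21 a b; have := set22 a b; rewrite eqs !inE.
have := set21 c d; have := set22 c d; rewrite -eqs !inE.
by rewrite ![_ == a]eq_sym ![_ == b]eq_sym; do 4![case: (_ == _) => //=].
Qed.

Lemma set2_flip (a b : 'I_4) :
  ([set a; b] == [set a2; a3]) = (1 < a) && (b == flip a).
Proof.
by rewrite set2_letters; case: (letterP a) => ->; case: (letterP b) => ->.
Qed.

Lemma set2_flip01 (a b : 'I_4) :
  ([set a; b] == [set a0; a1]) = (a < 2) && (b == flip a).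
Proof.
by rewrite set2_letters; case: (letterP a) => ->; case: (letterP b) => ->.
Qed.

(** * Edges described by a distinguished coordinate *)

Definition switch n (l : 'I_n) (x : word n) : word n :=
  [ffun i => if i == l then flip (x i) else x i].

(** Admitting coordinate 0 whatever its letter lets one notion serve both clauses (a) and (b) of the
    edge relation. *)
Definition pivot n (l : 'I_n) (x : word n) : bool :=
  ((l == 0 :> nat) || (1 < x l)) && [forall j : 'I_n, (l < j) ==> (x j < 2)].

Lemma switchK n (l : 'I_n) : involutive (switch l).
Proof.
by move=> x; apply/ffunP=> i; rewrite !ffunE; case: eqP; rewrite ?flipK.
Qed.

Lemma pivot_switch n (l : 'I_n) x : pivot l (switch l x) = pivot l x.
Proof.
rewrite /pivot ffunE eqxx flip_gt1; congr (_ && _).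
by apply: eq_forallb => j; rewrite ffunE; case: eqP => // ->; rewrite ltnn.
Qed.

(** The later of two pivots would be nonzero and so carry 2 or 3, but the letters after the earlier
    one are binary. *)
Lemma pivot_uniq n (l l' : 'I_n) x : pivot l x -> pivot l' x -> l = l'.
Proof.
move=> /andP[hl /forallP tl] /andP[hl' /forallP tl']; apply: val_inj.
case: (ltngtP l l') => // ll'.
  by case/orP: hl' => h; have := tl l'; rewrite ll' /=; lia.
by case/orP: hl => h; have := tl' l; rewrite ll' /=; lia.
Qed.

Lemma pivot_ex n (x : word n) : 0 < n -> exists l, pivot l x.
Proof.
case: n x => // n x _.
pose P (l : 'I_n.+1) := (l == 0 :> nat) || (1 < x l).
have P0 : P ord0 by [].
case: (arg_maxnP (fun l : 'I_n.+1 => val l) P0) => l Pl maxl.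
exists l; apply/andP; split=> //; apply/forallP=> j; apply/implyP=> lj.
rewrite ltnNge; apply/negP=> xj.
by have := maxl j; rewrite /P xj orbT => /(_ isT); move: lj => /=; lia.
Qed.

Lemma edgeP n (x y : word n) :
  edge x y <-> x = y \/ exists2 l, pivot l x & y = switch l x.
Proof.
have tailP (l : 'I_n) :
    y = switch l x -> forall k : 'I_n, l < k -> y k = x k.
  by move=> -> k lk; rewrite ffunE; case: eqP lk => // ->; rewrite ltnn.
split.
  case/or3P=> [/eqP|/existsP[l]|/existsP[l]]; first by left.
  - case/and3P=> /forallP hd; rewrite set2_flip => /andP[xl /eqP yl] /forallP tl.
    right; exists l.
      rewrite /pivot xl orbT; apply/forallP=> j; apply/implyP=> lj.
      by have := tl j; rewrite lj in_set01 => /andP[].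
    apply/ffunP=> i; rewrite ffunE; case: eqP => [->//|/eqP].
    rewrite -val_eqE neq_ltn => /orP[il|li].
      by have := hd i; rewrite il => /eqP.
    by have := tl i; rewrite li => /andP[/eqP].
  - case/and3P=> /eqP l0; rewrite set2_flip01 => /andP[xl /eqP yl] /forallP tl.
    right; exists l.
      rewrite /pivot l0; apply/forallP=> j; apply/implyP=> lj.
      by have := tl j; rewrite lj in_set01 => /andP[].
    apply/ffunP=> i; rewrite ffunE; case: eqP => [->//|/eqP].
    rewrite -val_eqE /= l0 -lt0n => li.
    by have := tl i; rewrite li => /andP[/eqP].
case=> [->|[l /andP[hl /forallP tl] yE]]; first exact: edge_refl.
have yl : y l = flip (x l) by rewrite yE ffunE eqxx.
have tl' (k : 'I_n) : l < k -> (x k == y k) && (x k \in [set a0; a1]).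
  move=> lk; rewrite in_set01 (tailP l yE k lk) eqxx /=.
  by have := tl k; rewrite lk.
(* The letter at the pivot selects the clause: 2 or 3 gives (a); otherwise the pivot is coordinate
   0, which gives (b). *)
case: (ltnP 1 (x l)) => xl.
  apply/or3P/Or32/existsP; exists l; apply/and3P; split.
  - apply/forallP=> k; apply/implyP=> kl.
    rewrite yE ffunE; case: (k =P l) kl => [->|_ _] //.
    by rewrite ltnn.
  - by rewrite set2_flip xl yl eqxx.
  - by apply/forallP=> k; apply/implyP/tl'.
move: hl; rewrite ltnNge xl orbF => /eqP l0.
apply/or3P/Or33/existsP; exists l; apply/and3P; split.
- by rewrite l0.
- by rewrite set2_flip01 yl eqxx ltnS xl.
- by apply/forallP=> k; apply/implyP=> k1; apply: tl'; rewrite l0.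
Qed.

(** * The perfect matching and its orientation *)

(* On the empty word, which has no pivot, [mate] is the identity. *)
Definition mate n (x : word n) : word n :=
  if [pick l | pivot l x] is Some l then switch l x else x.

(** Parity at the pivot orients each matching edge, from its even end to its odd end. *)
Definition oddw n (x : word n) : bool :=
  if [pick l | pivot l x] is Some l then odd (x l) else false.

Lemma mateE n (l : 'I_n) x : pivot l x -> mate x = switch l x.
Proof.
rewrite /mate => lx; case: pickP => [l' l'x|/(_ l)]; last by rewrite lx.
by rewrite (pivot_uniq lx l'x).
Qed.

Lemma oddwE n (l : 'I_n) x : pivot l x -> oddw x = odd (x l).
Proof.
rewrite /oddw => lx; case: pickP => [l' l'x|/(_ l)]; last by rewrite lx.
by rewrite (pivot_uniq lx l'x).
Qed.

Lemma mateK n : involutive (@mate n).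
Proof.
move=> x; rewrite {2}/mate; case: pickP => [l lx|no].
  by rewrite (@mateE _ l) ?switchK ?pivot_switch.
by rewrite /mate; case: pickP => // l; rewrite no.
Qed.

Lemma oddw_mate n (x : word n) : 0 < n -> oddw (mate x) = ~~ oddw x.
Proof.
move=> n0; have [l lx] := pivot_ex x n0.
rewrite (mateE lx) (oddwE lx) (@oddwE _ l) ?pivot_switch //.
by rewrite ffunE eqxx odd_flip.
Qed.

Lemma edge_mateE n (x y : word n) : edge x y <-> y = x \/ y = mate x.
Proof.
rewrite edgeP; split=> [[->|[l lx ->]]|[->|->]]; [by left| |by left|].
  by right; rewrite (mateE lx).
by rewrite /mate; case: pickP => [l lx|_]; [right; exists l|left].
Qed.

(** * Restriction and extension of words *)

(* [extend v c] is the word of length n that begins with v and then continues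
   with the letters c(k), ..., c(n-1). *)
Definition extend k n (v : word k) (c : nat -> 'I_4) : word n :=
  [ffun i : 'I_n => if insub (val i) is Some j then v j else c i].

Lemma extend_lt k n (kn : k <= n) (v : word k) c (i : 'I_k) :
  extend n v c (widen_ord kn i) = v i.
Proof. by rewrite ffunE /= valK. Qed.

Lemma extend_ge k n (v : word k) c (i : 'I_n) : k <= i -> extend n v c i = c i.
Proof. by move=> ki; rewrite ffunE insubF // ltnNge ki. Qed.

Lemma restriction_extend k n (kn : k <= n) (v : word k) c :
  restriction kn (extend n v c) = v.
Proof. by apply/ffunP=> i; rewrite ffunE extend_lt. Qed.

Lemma pivot_widen k n (kn : k <= n) (l : 'I_k) (x : word n) :
  pivot (widen_ord kn l) x -> pivot l (restriction kn x).
Proof.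
case/andP=> hl /forallP tl; rewrite /pivot ffunE hl /=.
by apply/forallP=> j; have := tl (widen_ord kn j); rewrite ffunE.
Qed.

Lemma pivot_extend k n (kn : k <= n) (l : 'I_k) (v : word k) (c : nat -> 'I_4) :
  (forall i, k <= i -> c i < 2) -> pivot l v ->
  pivot (widen_ord kn l) (extend n v c).
Proof.
move=> c2 /andP[hl /forallP tl]; rewrite /pivot extend_lt hl /=.
apply/forallP=> j; apply/implyP=> lj; case: (ltnP j k) => [jk|kj].
  have -> : j = widen_ord kn (Ordinal jk) by apply: val_inj.
  by rewrite extend_lt; have := tl (Ordinal jk); rewrite lj.
by rewrite extend_ge ?c2.
Qed.

Lemma restriction_switch k n (kn : k <= n) (l : 'I_k) (x : word n) :
  restriction kn (switch (widen_ord kn l) x) = switch l (restriction kn x).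
Proof. by apply/ffunP=> i; rewrite !ffunE -!val_eqE. Qed.

Lemma restriction_switch_ge k n (kn : k <= n) (l : 'I_n) (x : word n) :
  k <= l -> restriction kn (switch l x) = restriction kn x.
Proof.
move=> kl; apply/ffunP=> i; rewrite !ffunE -val_eqE /= ltn_eqF //.
exact: leq_trans (ltn_ord i) kl.
Qed.

(** A pivot below [k] is also the pivot of the restriction, so mates restrict to mates; a switch at
    or beyond [k] is invisible there. *)
Lemma restriction_mate k n (kn : k <= n) (x : word n) :
  edge (restriction kn x) (restriction kn (mate x)).
Proof.
rewrite /mate; case: pickP => [l lx|_]; last exact: edge_refl.
case: (ltnP l k) => [lk|kl]; last first.
  by rewrite restriction_switch_ge //; apply: edge_refl.
have lE : l = widen_ord kn (Ordinal lk) by apply: val_inj.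
apply/edgeP; right; exists (Ordinal lk).
  by apply: pivot_widen; rewrite -lE.
by rewrite -restriction_switch -lE.
Qed.

Section BinaryExtension.
Variables (k n : nat) (kn : k <= n) (v : word k) (c : nat -> 'I_4).
Hypotheses (k_gt0 : 0 < k) (c2 : forall i, k <= i -> c i < 2).

(** Binary letters after [v] leave the pivot in place. *)
Lemma restriction_mate_extend :
  restriction kn (mate (extend n v c)) = mate v.
Proof.
have [l lv] := pivot_ex v k_gt0.
rewrite (mateE (pivot_extend kn c2 lv)) (mateE lv).
by rewrite restriction_switch restriction_extend.
Qed.

Lemma oddw_extend : oddw (extend n v c) = oddw v.
Proof.
have [l lv] := pivot_ex v k_gt0.
by rewrite (oddwE (pivot_extend kn c2 lv)) (oddwE lv) extend_lt.
Qed.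

End BinaryExtension.

Section PivotExtension.
Variables (k n : nat) (kn : k < n) (v : word k) (c : nat -> 'I_4).
Hypotheses (ck : c k = a2) (c2 : forall i, k < i -> c i < 2).

(** The letter 2 at [k] moves the pivot past [v], so that the matching edge collapses to the loop at
    [v]. *)
Lemma pivot_extend_at : pivot (Ordinal kn) (extend n v c).
Proof.
rewrite /pivot extend_ge //= ck orbT; apply/forallP=> j; apply/implyP=> kj.
by rewrite extend_ge ?c2 // ltnW.
Qed.

Lemma restriction_mate_extend_at :
  restriction (ltnW kn) (mate (extend n v c)) = v.
Proof.
by rewrite (mateE pivot_extend_at) restriction_switch_ge // restriction_extend.
Qed.

Lemma oddw_extend_at : oddw (extend n v c) = false.
Proof. by rewrite (oddwE pivot_extend_at) extend_ge //= ck. Qed.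

End PivotExtension.

(** * Quotient maps and the inverse sequence of restrictions *)

Lemma surjective_codom (X Y : Defs.fgraph) (f : X -> Y) :
  (forall y, exists x, f x = y) -> forall y, y \in codom f.
Proof. by move=> surj y; have [x <-] := surj y; apply: codom_f. Qed.

(** Surjectivity comes from lifting the loops. *)
Lemma quotient_map_edges (X Y : Defs.fgraph) (f : X -> Y) :
  quotient_map f <-> graph_hom f /\
    forall p q : Y, adj p q -> exists a b : X, [/\ adj a b, f a = p & f b = q].
Proof.
split=> [[[hom st] surj]|[hom lift]].
  by split=> // p q; apply: st; apply: surjective_codom.
split; first by split=> // p q _ _; apply: lift.
by move=> y; have [a [b [_ fa _]]] := lift y y (adj_refl y); exists a.
Qed.

Lemma word0_eq (v w : word 0) : v = w.
Proof. by apply/ffunP=> -[]. Qed.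

Lemma restriction_quotient k n (kn : k <= n) : quotient_map (restriction kn).
Proof.
apply/quotient_map_edges; split.
  move=> x y /edge_mateE[->|->]; first exact: edge_refl.
  exact: restriction_mate.
move=> v w vw; pose x (u : word k) := extend n u (fun=> a0).
have [eqvw|wE] : v = w \/ (0 < k /\ w = mate v).
  case: k kn v w vw @x => [|k] kn v w vw _; first by left; apply: word0_eq.
  by case/edge_mateE: vw => ->; [left|right].
  exists (x v), (x w); rewrite !restriction_extend eqvw; split=> //.
  exact: edge_refl.
case: wE => k0 ->; exists (x v), (mate (x v)); split.
- by apply/edge_mateE; right.
- exact: restriction_extend.
- exact: restriction_mate_extend.
Qed.

Lemma restriction_inverse_sequence : inverse_sequence (G := Gn) (@restriction).
Proof.
split; first exact: restriction_quotient.
- by move=> n nn x; apply/ffunP=> i; rewrite ffunE; congr (x _); apply: val_inj.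
- move=> k m n km mn kn x; apply/ffunP=> i; rewrite !ffunE.
  by congr (x _); apply: val_inj.
Qed.

(** * Lifting through a quotient map onto [Gn k] *)

Section Lifting.

Variables (k : nat) (H : Defs.fgraph) (g : H -> Gn k).
Hypothesis g_quot : quotient_map g.

(** Coordinate [k] is reserved for the letter that tells loops from other edges of [Gn k]; each pair
    in [H * H] owns one of the [N] coordinates after it. *)
Let N := #|{: H * H}|.
Let n := k.+1 + N.
Let kn : k < n := leq_addr N k.+1.
Let r (x : word n) : word k := restriction (ltnW kn) x.

Let lies_over (x : word n) (t : H * H) :=
  [&& adj t.1 t.2, g t.1 == r x & g t.2 == r (mate x)].

Let named (x : word n) (t : H * H) :=
  x (rshift k.+1 (enum_rank t)) == a1.

Fact lies_over_ex x : exists t, lies_over x t.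
Proof.
have /quotient_map_edges[_ lift] := g_quot.
have [p [q [pq gp gq]]] := lift _ _ (restriction_mate (ltnW kn) x).
by exists (p, q); rewrite /lies_over /= pq gp gq !eqxx.
Qed.

(** The default covers words that name no pair lying over them, so every target is an edge of [H]
    with the right image. *)
Let target x : H * H :=
  if [pick t | lies_over x t && named x t] is Some t then t
  else xchoose (lies_over_ex x).

(** Both ends of a matching edge read the target of its even end, so their images are the two
    components of one edge of [H]. *)
Let f (x : Gn n) : H :=
  if oddw x then (target (mate x)).2 else (target x).1.

Fact target_over x : lies_over x (target x).
Proof.
by rewrite /target; case: pickP => [t /andP[]|_] //; apply: xchooseP.
Qed.

Fact lifting_over x : g (f x) = r x.
Proof.
rewrite /f; case: ifP => _; last by case/and3P: (target_over x) => _ /eqP.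
by case/and3P: (target_over (mate x)) => _ _ /eqP->; rewrite mateK.
Qed.

Fact lifting_mate x : ~~ oddw x -> (f x, f (mate x)) = target x.
Proof.
move=> /negPf ox; rewrite /f oddw_mate // ox /= mateK.
by case: (target x).
Qed.

Fact lifting_hom : graph_hom f.
Proof.
have main x : ~~ oddw x -> adj (f x) (f (mate x)).
  by move=> ox; case/and3P: (target_over x); rewrite -lifting_mate.
move=> x y /edge_mateE[->|->]; first exact: adj_refl.
case ox: (oddw x); last by apply: main; rewrite ox.
by rewrite adj_sym -{2}(mateK x); apply: main; rewrite oddw_mate // ox.
Qed.

(* The tail of the word is the indicator function of the pair t. *)
Let code (c : 'I_4) (t : H * H) (i : nat) : 'I_4 :=
  if i == k then c else if i == k.+1 + enum_rank t then a1 else a0.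

Fact code_lt2 c t i : k < i -> code c t i < 2.
Proof. by rewrite /code => /gtn_eqF ->; case: ifP. Qed.

(** After coordinate [k] there is a single [a1], at the place owned by [t]; hence [pick] in [target]
    has no other candidate. *)
Fact named_code (v : word k) c t t' :
  named (extend n v (code c t)) t' = (t' == t).
Proof.
rewrite /named extend_ge /=; last by lia.
rewrite /code gtn_eqF; last by lia.
rewrite eqn_add2l val_eqE (inj_eq enum_rank_inj).
by case: (t' == t).
Qed.

Fact target_code (v : word k) c t :
  lies_over (extend n v (code c t)) t -> target (extend n v (code c t)) = t.
Proof.
move=> over; rewrite /target; case: pickP => [t'|/(_ t)].
  by rewrite named_code => /andP[_ /eqP].
by rewrite over named_code eqxx.
Qed.

Fact lifting_mate_code (v : word k) c p q :
    let x := extend n v (code c (p, q)) in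
  ~~ oddw x -> lies_over x (p, q) -> f x = p /\ f (mate x) = q.
Proof.
by move=> x ox over; have := lifting_mate ox; rewrite target_code // => -[].
Qed.

Fact lifting_edges p q :
  adj p q -> exists a b : Gn n, [/\ adj a b, f a = p & f b = q].
Proof.
have mate_adj (x : Gn n) : adj x (mate x) by apply/edge_mateE; right.
have /quotient_map_edges[g_hom _] := g_quot.
(* Edges over a non-loop are first realised when [g p'] is the even end, since [f] sends even ends
   to first components. *)
have cross p' q' : 0 < k -> adj p' q' -> g q' = mate (g p') ->
    ~~ oddw (g p') -> exists x : Gn n, f x = p' /\ f (mate x) = q'.
  (* The letter [a0] at [k] keeps the whole tail binary, so the pivot stays inside [g p']. *)
  move=> k0 pq gq op; pose c := code a0 (p', q').
  have c2 i : k <= i -> c i < 2 by rewrite /c /code; do 2!case: ifP => //.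
  exists (extend n (g p') c); apply: lifting_mate_code.
    by rewrite oddw_extend // ltnW.
  apply/and3P; split=> //=; rewrite /r ?restriction_extend //.
  by rewrite restriction_mate_extend ?gq.
move=> pq; have [gpq|[k0 gq]] : g q = g p \/ (0 < k /\ g q = mate (g p)).
  (* For [k = 0] only loops occur, [Gn 0] having a single vertex. *)
  case: (posnP k) => [k0|k0]; last first.
    by case/edge_mateE: (g_hom _ _ pq); [left|right].
  by left; apply/ffunP=> -[i ik]; exfalso; rewrite k0 in ik.
  (* The letter [a2] makes [k] the pivot and, being even, makes [x] the even end. *)
  pose c := code a2 (p, q); pose x := extend n (g p) c.
  have ck : c k = a2 by rewrite /c /code eqxx.
  have c2 i : k < i -> c i < 2 by apply: code_lt2.
  exists x, (mate x).
  have [] // := @lifting_mate_code (g p) a2 p q.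
  - by rewrite (oddw_extend_at kn).
  - apply/and3P; split=> //=; rewrite /r ?restriction_extend //.
    by rewrite restriction_mate_extend_at ?gpq.
(* If [g p] is the odd end, the reversed edge is realised and its ends are exchanged. *)
case op: (oddw (g p)).
  have [|||x [fx fmx]] := cross q p k0.
  - by rewrite adj_sym.
  - by rewrite gq mateK.
  - by rewrite gq oddw_mate // op.
  by exists (mate x), x; rewrite adj_sym.
have [|x [fx fmx]] := cross p q k0 pq gq; first by rewrite op.
by exists x, (mate x).
Qed.

Lemma restriction_lifting :
  exists (n : nat) (kn : k < n) (f : Gn n -> H),
    quotient_map f /\ g \o f =1 restriction (ltnW kn).
Proof.
exists n, kn, f; split; last exact: lifting_over.
by apply/quotient_map_edges; split; [apply: lifting_hom|apply: lifting_edges].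
Qed.

End Lifting.

Theorem proposition3p7 : fraisse_sequence (G := Gn) (@restriction).
Proof.
split; first exact: restriction_inverse_sequence.
by move=> k H g; apply: restriction_lifting.
Qed.
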